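(* Let $\beta\mathrel{|\!\sim}\gamma$ be defined by $\mu(M(\beta))\subseteq M(\gamma)$, where $\mu(A)$ is the generator of the principal filter of big subsets of $A$. Suppose that one of the following holds: (1) both $(S*1)$ and $(S*2)$ hold; or (2) $(S*3)$ holds. Then interpolation of the form $\varphi\vdash\alpha\mathrel{|\!\sim}\psi$ exists: for all formulas $\varphi,\psi$ with $\varphi\mathrel{|\!\sim}\psi$ there is a formula $\alpha$, containing only propositional variables which occur in both $\varphi$ and $\psi$, such that $\varphi\vdash\alpha$ (i.e. $M(\varphi)\subseteq M(\alpha)$) and $\alpha\mathrel{|\!\sim}\psi$ (i.e. $\mu(M(\alpha))\subseteq M(\psi)$).
   Context: Classical two-valued propositional language with set of variables $L$ and constants TRUE, FALSE; $M(\varphi)\subseteq\{0,1\}^L$ is the set of models of $\varphi$. For $Y\subseteq L$ let $\Pi_Y=\{0,1\}^Y$; for disjoint $Y',Y''$ identify $\Pi_{Y'\cup Y''}$ with $\Pi_{Y'}\times\Pi_{Y''}$; for $\Sigma\subseteq\Pi_Y$ and $Y'\subseteq Y$ let $\Sigma\restriction Y'=\{\sigma\restriction Y':\sigma\in\Sigma\}$. For every $Y\subseteq L$ and $A\subseteq\Pi_Y$ a set $\mu(A)\subseteq A$ is given; $B\subseteq A$ is called big (in $A$) iff $\mu(A)\subseteq B\subseteq A$. The conditions, for all disjoint $X',X''\subseteq L$ with $X=X'\cup X''$, are: $(S*1)$ for all $\Sigma'\subseteq\Pi_{X'}$, $\Sigma''\subseteq\Pi_{X''}$, $\Delta\subseteq\Sigma'\times\Sigma''$: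 $\Delta$ is big in $\Sigma'\times\Sigma''$ iff there are $\Gamma'\subseteq\Sigma'$ big and $\Gamma''\subseteq\Sigma''$ big with $\Gamma'\times\Gamma''\subseteq\Delta$. $(S*2)$ for all $\Gamma\subseteq\Sigma\subseteq\Pi_X$ ($\Sigma$ not necessarily a product): if $\Gamma\subseteq\Sigma$ is big, then $\Gamma\restriction X'\subseteq\Sigma\restriction X'$ is big. $(S*3)$ for all $A\subseteq\Sigma\subseteq\Pi_X$ ($\Sigma$ not necessarily a product): if $A\subseteq\Sigma$ is big, then there is a big $B\subseteq\Pi_{X'}\times(\Sigma\restriction X'')$ with $B\restriction X''\subseteq A\restriction X''$. *)

(* Defs.v *)
From mathcomp Require Export all_boot.
From mathcomp Require Export boolp classical_sets functions.
Set Implicit Arguments.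
Unset Strict Implicit.
Unset Printing Implicit Defensive.
Local Open Scope classical_set_scope.

Inductive formula (L : Type) : Type :=
  | FVar of L
  | FTrue
  | FFalse
  | FNot of formula L
  | FAnd of formula L & formula L
  | FOr of formula L & formula L
  | FImp of formula L & formula L.

Arguments FTrue {L}.
Arguments FFalse {L}.

Fixpoint eval (L : Type) (v : L -> bool) (f : formula L) : bool :=
  match f with
  | FVar p => v p
  | FTrue => true
  | FFalse => false
  | FNot g => ~~ eval v g
  | FAnd g h => eval v g && eval v h
  | FOr g h => eval v g || eval v h
  | FImp g h => eval v g ==> eval v h
  end.

Fixpoint vars (L : Type) (f : formula L) : set L :=
  match f with
  | FVar p => [set p]
  | FTrue | FFalse => set0
  | FNot g => vars g
  | FAnd g h | FOr g h | FImp g h => vars g `|` vars h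
  end.

(* {0,1}^Y: assignments defined on Y only (Y is coerced to a subtype of L). *)
Definition Pi (L : Type) (Y : set L) : Type := Y -> bool.

(* {0,1}^L is [Pi [set: L]]. *)
Definition models (L : Type) (f : formula L) : set (Pi [set: L]) :=
  [set s | eval (fun p => s (SigSub (in_setT p))) f].

Definition entails (L : Type) (f g : formula L) : Prop :=
  models f `<=` models g.

Definition restr (L : Type) (X Y : set L) (YX : Y `<=` X) (s : Pi X) : Pi Y :=
  s \o subfun YX.

Definition restrS (L : Type) (X Y : set L) (YX : Y `<=` X) (S : set (Pi X)) :
  set (Pi Y) := restr YX @` S.

(* When X is the disjoint union of X1 and X2, an element of Pi X is identified
   with the pair of its restrictions; this is S1 x S2 as a subset of Pi X. *)
Definition prodS (L : Type) (X X1 X2 : set L) (X1X : X1 `<=` X) (X2X : X2 `<=` X)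
  (S1 : set (Pi X1)) (S2 : set (Pi X2)) : set (Pi X) :=
  restr X1X @^-1` S1 `&` restr X2X @^-1` S2.

Definition disjoint_union (L : Type) (X X1 X2 : set L) : Prop :=
  X1 `&` X2 = set0 /\ X = X1 `|` X2.

Definition subset_selection (L : Type) : Type :=
  forall Y : set L, set (Pi Y) -> set (Pi Y).

Definition is_big (L : Type) (mu : subset_selection L) (Y : set L)
  (B A : set (Pi Y)) : Prop :=
  mu Y A `<=` B /\ B `<=` A.

(* The inclusions X1X and X2X follow from [disjoint_union X X1 X2]; they are
   bound separately only because restriction takes them as arguments. *)
Definition Sstar1 (L : Type) (mu : subset_selection L) : Prop :=
  forall (X X1 X2 : set L) (X1X : X1 `<=` X) (X2X : X2 `<=` X),
    disjoint_union X X1 X2 ->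
  forall (S1 : set (Pi X1)) (S2 : set (Pi X2)) (D : set (Pi X)),
    D `<=` prodS X1X X2X S1 S2 ->
    (is_big mu D (prodS X1X X2X S1 S2) <->
     exists (G1 : set (Pi X1)) (G2 : set (Pi X2)),
       [/\ is_big mu G1 S1, is_big mu G2 S2 & prodS X1X X2X G1 G2 `<=` D]).

Definition Sstar2 (L : Type) (mu : subset_selection L) : Prop :=
  forall (X X1 X2 : set L) (X1X : X1 `<=` X) (X2X : X2 `<=` X),
    disjoint_union X X1 X2 ->
  forall G S : set (Pi X), G `<=` S ->
    is_big mu G S -> is_big mu (restrS X1X G) (restrS X1X S).

Definition Sstar3 (L : Type) (mu : subset_selection L) : Prop :=
  forall (X X1 X2 : set L) (X1X : X1 `<=` X) (X2X : X2 `<=` X),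
    disjoint_union X X1 X2 ->
  forall A S : set (Pi X), A `<=` S ->
    is_big mu A S ->
    exists B : set (Pi X),
      is_big mu B (prodS X1X X2X [set: Pi X1] (restrS X2X S)) /\
      restrS X2X B `<=` restrS X2X A.

Definition nmcons (L : Type) (mu : subset_selection L) (f g : formula L) :
  Prop :=
  mu [set: L] (models f) `<=` models g.

(* Main.v *)
Require Import Defs.
Set Implicit Arguments.
Unset Strict Implicit.
Local Open Scope classical_set_scope.

(** Let D be the set of variables of phi that do not occur in psi, and let
    alpha say that the values of the variables in D can be changed so as to
    make phi true.  Then alpha uses shared variables only, and phi entails it.
    The models of alpha are the product of {0,1}^D with the projection of
    M(phi) to the complement of D ([models_projection]), which is the product
    that [Sstar3] speaks of.  So [Sstar3], applied to the big subset mu(M(phi))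
    of M(phi), makes every element of mu(M(alpha)) agree outside D with some
    element of mu(M(phi)), hence with a model of psi; and the truth of psi does
    not depend on the variables in D.

    The other hypothesis needs no separate argument: [Sstar1] and [Sstar2]
    together imply [Sstar3] ([Sstar12_Sstar3]). *)

(** * Elimination of variables *)

Section Elimination.
Variable L : Type.
Implicit Types (f g : formula L) (v w : L -> bool) (D : set L).

Lemma eval_agree f v w : (forall p, vars f p -> v p = w p) ->
  eval v f = eval w f.
Proof.
elim: f => //= [p|f IH|f IHf g IHg|f IHf g IHg|f IHf g IHg] vw.
- exact: vw.
- by rewrite IH.
- by rewrite IHf ?IHg// => p pf; apply: vw; [right|left].
- by rewrite IHf ?IHg// => p pf; apply: vw; [right|left].
- by rewrite IHf ?IHg// => p pf; apply: vw; [right|left].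
Qed.

Definition update p (b : bool) v : L -> bool :=
  fun q => if `[< q = p >] then b else v q.

Fixpoint instantiate p (b : bool) f : formula L :=
  match f with
  | FVar q => if `[< q = p >] then (if b then FTrue else FFalse) else FVar q
  | FTrue => FTrue
  | FFalse => FFalse
  | FNot g => FNot (instantiate p b g)
  | FAnd g h => FAnd (instantiate p b g) (instantiate p b h)
  | FOr g h => FOr (instantiate p b g) (instantiate p b h)
  | FImp g h => FImp (instantiate p b g) (instantiate p b h)
  end.

Lemma eval_instantiate p b f v :
  eval v (instantiate p b f) = eval (update p b v) f.
Proof.
elim: f => //= [q|g ->|g -> h ->|g -> h ->|g -> h ->] //.
by rewrite /update; case: asboolP => // _; case: b.
Qed.

Lemma vars_instantiate p b f : vars (instantiate p b f) `<=` vars f `\ p.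
Proof.
elim: f => //= [q|g IHg h IHh|g IHg h IHh|g IHg h IHh].
- by case: asboolP => [_|qp] x /=; [case: b | move=> ->].
- by rewrite setDUl; apply: setUSS.
- by rewrite setDUl; apply: setUSS.
- by rewrite setDUl; apply: setUSS.
Qed.

(** The existential quantification of any formula over the variables in [D] is
    expressible by a formula.  A property of the set [D] that is closed under
    unions can be obtained for [vars g `\` W] by induction on [g], with no
    enumeration of the variables and no decidable equality on them. *)
Definition eliminable D : Prop :=
  forall f, exists2 g, vars g `<=` vars f `\` D &
    forall v, eval v g <->
      exists2 w, (forall p, ~ D p -> w p = v p) & eval w f.

Lemma eliminable0 : eliminable set0.
Proof.
move=> f; exists f; first by rewrite setD0.
move=> v; split=> [fv|[w wv]]; first by exists v.
by rewrite (@eval_agree f w v) // => p _; apply: wv.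
Qed.

(** Shannon expansion: there is a suitable value of [p] if and only if the
    instance at true or the instance at false holds. *)
Lemma eliminable1 p : eliminable [set p].
Proof.
move=> f; exists (FOr (instantiate p true f) (instantiate p false f)).
  by rewrite /= subUset; split; apply: vars_instantiate.
move=> v /=; rewrite !eval_instantiate; split.
  have upd b q : q <> p -> update p b v q = v q.
    by rewrite /update; case: asboolP.
  by case/orP => fv; [exists (update p true v) | exists (update p false v)];
    rewrite // => q; apply: upd.
case=> w wv fw.
have -> : eval (update p true v) f || eval (update p false v) f =
          has (fun b => eval (update p b v) f) [:: true; false].
  by rewrite /= orbF.
apply/hasP; exists (w p); first by case: (w p).
rewrite (@eval_agree f _ w) // => q _.
by rewrite /update; case: asboolP => [->|/wv].
Qed.

Lemma eliminableU D1 D2 :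
  eliminable D1 -> eliminable D2 -> eliminable (D1 `|` D2).
Proof.
move=> e1 e2 f; have [g gf gP] := e1 f; have [h hg hP] := e2 g.
exists h; first by move=> p /hg[/gf[fp D1p] D2p]; split=> // -[].
move=> v; rewrite hP; split.
  case=> u uv /gP[w wu fw]; exists w => // p /not_orP[D1p D2p].
  by rewrite wu // uv.
case=> w wv fw.
(* The intermediate assignment changes [v] on [D2] only. *)
exists (fun p => if `[< D2 p >] then w p else v p).
  by move=> p D2p; case: asboolP.
apply/gP; exists w => // p D1p; case: asboolP => // D2p.
by apply: wv => -[].
Qed.

Lemma eliminable_varsD g (W : set L) : eliminable (vars g `\` W).
Proof.
elim: g => //= [p|||g IHg h IHh|g IHg h IHh|g IHg h IHh].
- have [Wp|Wp] := pselect (W p).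
    suff -> : [set p] `\` W = set0 by exact: eliminable0.
    by rewrite -subset0 => q [/= -> /(_ Wp)].
  suff -> : [set p] `\` W = [set p] by exact: eliminable1.
  by apply/seteqP; split=> q /= => [[]//|->].
- by rewrite set0D; exact: eliminable0.
- by rewrite set0D; exact: eliminable0.
- by rewrite setDUl; exact: eliminableU.
- by rewrite setDUl; exact: eliminableU.
- by rewrite setDUl; exact: eliminableU.
Qed.

End Elimination.

(** * Models and products *)

(** [Pi [set: L]] consists of functions on a subtype of [L], while [eval] takes
    functions on [L] itself. *)
Definition assignment (L : Type) (s : Pi [set: L]) : L -> bool :=
  fun p => s (SigSub (in_setT p)).

Lemma restr_eqP (L : Type) (Y : set L) (YX : Y `<=` [set: L])
    (s t : Pi [set: L]) :
  restr YX s = restr YX t <-> forall p, Y p -> assignment s p = assignment t p.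
Proof.
have restrE u (y : Y) : restr YX u y = assignment u (val y).
  by rewrite /restr /assignment /=; congr (u _); apply: val_inj.
split=> [st p Yp|st].
  by have := congr1 (@^~ (SigSub (mem_set Yp))) st; rewrite !restrE.
by apply: funext => y; rewrite !restrE; apply: st; exact: set_valP.
Qed.

(** Elimination of [D] forgets the coordinates in [D]: semantically it is the
    cylinder over the projection to the other coordinates. *)
Lemma models_projection (L : Type) (D : set L) (DX : D `<=` [set: L])
    (CX : ~` D `<=` [set: L]) (f g : formula L) :
  (forall v, eval v g <->
     exists2 w, (forall p, ~ D p -> w p = v p) & eval w f) ->
  models g = prodS DX CX [set: Pi D] (restrS CX (models f)).
Proof.
move=> gP; apply/seteqP; split=> [t /gP[w wt fw]|t [_ [s fs /restr_eqP st]]].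
  split=> //; exists (fun x => w (val x)) => //.
  by apply/restr_eqP => p Dp; apply: wt.
by apply/gP; exists (assignment s).
Qed.

(** * Interpolation *)

(** A projection of a big set is big by [Sstar2], so by [Sstar1] its product
    with the whole of {0,1}^X1 is big too, and that product projects back into
    it. *)
Lemma Sstar12_Sstar3 (L : Type) (mu : subset_selection L) :
  Sstar1 mu -> Sstar2 mu -> Sstar3 mu.
Proof.
move=> S1 S2 X X1 X2 X1X X2X dX A S AS bigA.
have dX' : disjoint_union X X2 X1.
  by case: dX => dj ->; split; [rewrite setIC | rewrite setUC].
have bigA2 := S2 _ _ _ X2X X1X dX' A S AS bigA.
exists (prodS X1X X2X setT (restrS X2X A)); split; last first.
  by move=> _ [s [_ As] <-].
have DS : prodS X1X X2X setT (restrS X2X A) `<=`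
          prodS X1X X2X setT (restrS X2X S).
  by move=> s [_ As]; split=> //; apply: bigA2.2.
apply/(S1 _ _ _ X1X X2X dX _ _ _ DS).
by exists setT, (restrS X2X A); split.
Qed.

Theorem proposition5p3p3 (L : Type) (mu : subset_selection L)
  (mu_sub : forall (Y : set L) (A : set (Pi Y)), mu Y A `<=` A)
  (hS : (Sstar1 mu /\ Sstar2 mu) \/ Sstar3 mu) :
  forall phi psi : formula L, nmcons mu phi psi ->
    exists alpha : formula L,
      [/\ vars alpha `<=` vars phi `&` vars psi,
          entails phi alpha
        & nmcons mu alpha psi].
Proof.
have {hS} S3 : Sstar3 mu by case: hS => // -[]; exact: Sstar12_Sstar3.
move=> phi psi phi_psi.
pose D := vars phi `\` vars psi.
have [alpha alpha_vars alphaP] := @eliminable_varsD L phi (vars psi) phi.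
exists alpha; split.
- move=> p /alpha_vars[phip nDp]; split=> //.
  by apply: contrapT => psip; apply: nDp.
- by move=> s phis; apply/alphaP; exists (assignment s).
- have DX := @subsetT _ D; have CX := @subsetT _ (~` D).
  have dD : disjoint_union [set: L] D (~` D).
    by rewrite /disjoint_union setICr setUv.
  have big_mu : is_big mu (mu _ (models phi)) (models phi).
    by split; last exact: mu_sub.
  have [B [[muB _] BA]] := S3 _ _ _ DX CX dD _ _ (@mu_sub _ _) big_mu.
  rewrite /nmcons (models_projection DX CX alphaP) => t /muB Bt.
  have [s /phi_psi psis /restr_eqP st] :
      restrS CX (mu _ (models phi)) (restr CX t) by apply: BA; exists t.
  rewrite /models /= -/(assignment t) -(@eval_agree _ psi (assignment s)) //.
  by move=> p psip; apply: st => -[].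
Qed.
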